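(* Let $G$ be a connected unicyclic graph of order $n$. Then $Z(G)+Z(\overline{G})=\delta(G)+\delta(\overline{G})$ if and only if $G$ is the cycle $C_n$ with $n \ge 5$.
   Context: A connected graph is unicyclic if it contains exactly one cycle (equivalently, its number of edges equals its number of vertices). For a finite simple graph $G$, color a set $S\subseteq V(G)$ black and all other vertices white. The color-change rule: if a black vertex $u$ has exactly one white neighbor $w$, then $w$ is turned black. $S$ is a zero forcing set if repeated application of the rule eventually turns all vertices black; $Z(G)$ is the minimum size of a zero forcing set. $\overline{G}$ denotes the complement of $G$ and $\delta(\cdot)$ the minimum degree. *)

(* Defs.v *)
(* A finite simple graph is a symmetric irreflexive e : rel T on a
   finType T. *)
From mathcomp Require Import all_boot.

Set Implicit Arguments.
Unset Strict Implicit.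
Unset Printing Implicit Defensive.

Section Graphs.

Variables (T : finType) (e : rel T).

Definition compl_graph : rel T := [rel x y | (x != y) && ~~ e x y].

Definition neighbors (x : T) : {set T} := [set y | e x y].

(* Every degree is below #|T|, so the initial value #|T| is never the minimum
   when T is nonempty. *)
Definition min_degree : nat := \big[minn/#|T|]_(x : T) #|neighbors x|.

Definition connected_graph : Prop :=
  0 < #|T| /\ forall x y : T, connect e x y.

(* A cycle is a subgraph without isolated vertices, hence it is identified with
   its edge set: different starting points and orientations of the vertex
   sequence c give the same cycle. *)
Definition cycle_edges (c : seq T) : {set {set T}} :=
  [set [set x; next c x] | x in c].

Definition is_cycle (C : {set {set T}}) : Prop :=
  exists c : seq T, [/\ 2 < size c, ucycle e c & C = cycle_edges c].

Definition unicyclic : Prop :=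
  connected_graph /\ exists! C : {set {set T}}, is_cycle C.

Definition force_step : rel {set T} :=
  [rel B B' : {set T} |
    [exists u in B, exists w, (neighbors u :\: B == [set w])
                              && (B' == w |: B)]].

Definition zero_forcing_set (S : {set T}) : bool :=
  connect force_step S [set: T].

(* [set: T] is always a zero forcing set, so the arg min is meaningful. *)
Definition zero_forcing_number : nat :=
  #|[arg min_(S < [set: T] | zero_forcing_set S) #|S|]|.

End Graphs.

(* The cycle C_n, meaningful for 3 <= n; ordS is the cyclic successor. *)
Definition cycle_graph (n : nat) : rel 'I_n :=
  [rel i j | (ordS i == j) || (ordS j == i)].

Definition graph_isomorphic (T U : finType) (e : rel T) (f : rel U) : Prop :=
  exists h : T -> U, bijective h /\ forall x y, e x y = f (h x) (h y).

(* Main.v *)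
(** A force needs all but one of the neighbors of the forcing vertex to be
    black, so [Z >= delta] for every graph and the equality splits into
    [Z(G) = delta(G)] and [Z(co-G) = delta(co-G)].  A graph with a cycle has
    [Z >= 2], hence all degrees of [G] are at least 2.  Extend an edge [xy]
    with [x] on the cycle to a maximal simple path [x, y, ...]; its last vertex
    has two neighbors on the path, which closes a cycle.  By uniqueness that
    cycle contains [x], so it contains the edge [xy]: all edges at the cycle
    belong to it, and [G] is the cycle.  In the complement of [C_n], coloring
    [n-1, 1, 2] white gives the forces [0 -> 2 -> n-1 -> 1] when [n >= 5],
    whereas for [n <= 4] the complement has maximum degree at most 1, and then
    [n <= 2 Z]. *)
Require Import Defs.
From mathcomp Require Import all_boot.
From mathcomp Require Import zify.

Section ZeroForcing.

Set Implicit Arguments.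
Unset Strict Implicit.

Variables (T : finType) (e : rel T).

(** * Minimum degree and bounds on the zero forcing number *)

Lemma min_degree_le x : min_degree e <= #|neighbors e x|.
Proof.
rewrite /min_degree; have: x \in index_enum T by rewrite mem_index_enum.
elim: (index_enum T) => // y s IHs; rewrite inE big_cons.
by case/predU1P=> [->|/IHs xs]; rewrite geq_min ?leqnn // xs orbT.
Qed.

Lemma min_degree_regular d :
  0 < #|T| -> (forall x, #|neighbors e x| = d) -> min_degree e = d.
Proof.
case/card_gt0P => x0 _ deg_d; apply/eqP; rewrite eqn_leq.
rewrite -{1}(deg_d x0) min_degree_le /=.
rewrite /min_degree; elim/big_ind: _ => [|a b da db|x _].
- by rewrite -(deg_d x0) max_card.
- by rewrite leq_min da db.
- by rewrite deg_d.
Qed.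

Lemma zero_forcing_number_le S :
  zero_forcing_set e S -> zero_forcing_number e <= #|S|.
Proof.
rewrite /zero_forcing_number; case: arg_minnP => [|S0 _ min_S0]; first exact: connect0.
exact: min_S0.
Qed.

Lemma zero_forcing_number_attained :
  exists2 S, zero_forcing_set e S & #|S| = zero_forcing_number e.
Proof.
rewrite /zero_forcing_number; case: arg_minnP => [|S zS _]; first exact: connect0.
by exists S.
Qed.

Lemma zero_forcing_ind (P : {set T} -> Prop) S :
  (forall (B : {set T}) u w,
     P B -> u \in B -> neighbors e u :\: B = [set w] -> P (w |: B)) ->
  zero_forcing_set e S -> P S -> P [set: T].
Proof.
move=> stepP /connectP[p]; elim: p S => [|B p IHp] S /=; first by move=> _ ->.
case/andP=> /existsP[u /andP[uS /existsP[w /andP[/eqP Nu /eqP ->]]]] pth lst PS.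
by apply: (IHp (w |: S)) => //; apply: stepP PS uS Nu.
Qed.

Lemma zero_forcing_set_force u w (B : {set T}) :
  u \in B -> (forall y, e u y && (y \notin B) = (y == w)) ->
  zero_forcing_set e (w |: B) -> zero_forcing_set e B.
Proof.
move=> uB Nu; apply: connect_trans; apply: connect1.
apply/existsP; exists u; rewrite uB; apply/existsP; exists w; rewrite eqxx andbT.
by apply/eqP/setP=> y; rewrite !inE andbC Nu.
Qed.

(** The first forcing vertex [u] has all its neighbors but one in [S]; the missing one is offset by
    [u] itself, which lies in [S] and is not its own neighbor. If no force takes place, [S] is
    already the whole vertex set. *)
Lemma min_degree_le_zero_forcing_number :
  0 < #|T| -> irreflexive e -> min_degree e <= zero_forcing_number e.
Proof.
move=> T_gt0 e_irr; have [S zS <-] := zero_forcing_number_attained.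
move: zS => /connectP[[|B p] /=].
  move=> _ <-; case/card_gt0P: T_gt0 => x _.
  by apply: leq_trans (min_degree_le x) _; apply: subset_leq_card; apply: subsetT.
case/andP=> /existsP[u /andP[uS /existsP[w /andP[/eqP Nu _]]]] _ _.
apply: leq_trans (min_degree_le u) _.
rewrite -(cardsID S) Nu cards1 addn1 (cardsD1 u S) uS ltnS.
apply: subset_leq_card; apply/subsetP => y; rewrite !inE => /andP[uy ->].
by rewrite andbT; apply: contraTneq uy => ->; rewrite e_irr.
Qed.

(* Invariant: some vertex [a] is the only black vertex that may have a white
   neighbor or lie in [C].  Once [a] lies in [C] it has two white neighbors and
   no further force is possible. *)
Lemma zero_forcing_number_ge2 (C : {set T}) :
  irreflexive e -> C != set0 ->
  (forall x, x \in C -> 1 < #|C :&: neighbors e x|) ->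
  1 < zero_forcing_number e.
Proof.
move=> e_irr /set0Pn[c0 c0C] C2; have [S zS <-] := zero_forcing_number_attained.
rewrite ltnNge; apply/negP => S1.
pose P (B : {set T}) :=
  exists a, forall x, x \in B -> x != a -> neighbors e x \subset B /\ x \notin C.
have: P [set: T].
  apply: zero_forcing_ind zS _; last first.
    move: S1; rewrite leq_eqVlt ltnS leqn0 => /orP[/cards1P[a ->]|].
      by exists a => x; rewrite inE => ->.
    by rewrite cards_eq0 => /eqP ->; exists c0 => x; rewrite inE.
  move=> B u w [a Pa] uB Nu.
  have wNu : w \in neighbors e u :\: B by rewrite Nu set11.
  have ua : u = a.
    apply/eqP/negPn/negP => /(Pa u uB)[/subsetP sNB _].
    by move: wNu; rewrite in_setD => /andP[/negP wB /sNB].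
  subst a; have uC : u \notin C.
    apply/negP => /C2; rewrite ltnNge => /negP; apply.
    rewrite -(cards1 w) -Nu; apply: subset_leq_card; apply/subsetP => y.
    rewrite !inE => /andP[yC uy]; rewrite uy andbT; apply/negP => yB.
    have yu : y != u by apply: contraTneq uy => ->; rewrite e_irr.
    by have [_] := Pa y yB yu; rewrite yC.
  (* The role of [a] passes to [w]: after the force, [u] has only black neighbors, and it lies
     outside [C]. *)
  exists w => x; rewrite in_setU1 => /orP[-> //|xB] xw.
  have [->|xu] := eqVneq x u.
    split=> //; apply/subsetP => y uy; rewrite in_setU1 orbC.
    by case yB: (y \in B) => //=; rewrite -in_set1 -Nu in_setD yB.
  have [sNB xC] := Pa x xB xu; split=> //.
  exact: subset_trans sNB (subsetUr _ _).
(* For the full vertex set the invariant leaves at most the vertex [a] in [C], too few for two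
   neighbors inside [C]. *)
case=> a Pa; have C_a x : x \in C -> x = a.
  by move=> xC; apply/eqP/negPn/negP => /(Pa x (in_setT x))[_]; rewrite xC.
have := C2 c0 c0C; rewrite ltnNge => /negP; apply.
rewrite -(cards1 a); apply: subset_leq_card; apply/subsetP => y.
by rewrite !inE => /andP[/C_a ->].
Qed.

(** Black vertices never leave the closed neighborhood [N] of [S]: a vertex of [N] outside [S] has
    its only neighbor in [S], so it forces nothing new. With degrees at most 1, [N] has at most
    twice the size of [S]. *)
Lemma card_le_double_zero_forcing_number :
  symmetric e -> (forall x, #|neighbors e x| <= 1) ->
  #|T| <= (zero_forcing_number e).*2.
Proof.
move=> e_sym deg1; have [S zS <-] := zero_forcing_number_attained.
pose N := S :|: \bigcup_(x in S) neighbors e x.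
have sTN : [set: T] \subset N.
  apply: (@zero_forcing_ind (fun B => B \subset N)) zS _; last exact: subsetUl.
  move=> B u w sBN /(subsetP sBN) uN Nu; apply/subsetP => y.
  rewrite in_setU1 => /orP[/eqP ->|/(subsetP sBN) //].
  have: w \in neighbors e u :\: B by rewrite Nu set11.
  rewrite !inE => /andP[_ uw].
  move: uN; rewrite in_setU => /orP[uS|/bigcupP[a aS]].
    by apply/orP; right; apply/bigcupP; exists u; rewrite ?inE.
  rewrite inE e_sym => ua; suff -> : w = a by rewrite aS.
  by apply: (card_le1_eqP (deg1 u)); rewrite inE.
rewrite -cardsT; apply: leq_trans (subset_leq_card sTN) _.
apply: leq_trans (leq_card_setU _ _) _; rewrite -addnn leq_add2l.
apply: (@leq_trans (\sum_(x in S) 1)); last by rewrite sum1_card.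
apply: (@leq_trans (\sum_(x in S) #|neighbors e x|)); last by apply: leq_sum.
elim/big_rec2: _ => [|x m A _ Am]; first by rewrite cards0.
by apply: leq_trans (leq_card_setU _ _) _; rewrite leq_add2l.
Qed.

Lemma card_neighbors_compl x :
  irreflexive e -> #|neighbors (compl_graph e) x| = #|T| - #|neighbors e x|.+1.
Proof.
move=> e_irr; have -> : neighbors (compl_graph e) x = ~: (x |: neighbors e x).
  by apply/setP=> y; rewrite !inE negb_or eq_sym.
by rewrite cardsCs setCK cardsU1 inE e_irr add1n.
Qed.

(** * Maximal paths and the cycles they close *)

Lemma maximal_path x p :
  path e x p -> uniq (x :: p) ->
  exists q, [/\ path e x (p ++ q), uniq (x :: p ++ q)
    & forall z, e (last x (p ++ q)) z -> z \in x :: p ++ q].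
Proof.
have [m] := ubnP (#|T| - size p); elim: m p => // m IHm p le_m pth unq.
have [/existsP[z /andP[ez zp]]|max] :=
  boolP [exists z, e (last x p) z && (z \notin x :: p)]; last first.
  exists [::]; rewrite cats0; split=> // z ez; apply: contraNT max => zp.
  by apply/existsP; exists z; rewrite ez.
have unq' : uniq (x :: rcons p z) by rewrite -rcons_cons rcons_uniq zp.
have [|||q] := IHm (rcons p z).
- have: size (x :: rcons p z) <= #|T| by rewrite -(card_uniqP unq') max_card.
  by rewrite /= size_rcons; move: le_m; move: #|T| (size p); lia.
- by rewrite rcons_path pth.
- by [].
by rewrite cat_rcons => Hq; exists (z :: q).
Qed.

(** Reads vertices off the edge set, so that they can be carried over between two sequences with the
    same edges. *)
Lemma mem_cycle_edges (c : seq T) x y :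
  [set x; y] \in cycle_edges c -> x \in c.
Proof.
case/imsetP=> z zc /setP/(_ x); rewrite !inE eqxx /= => /esym/orP[]/eqP-> //.
by rewrite mem_next.
Qed.

(** Take a maximal path starting with [x], [y]. Its end [z] has two neighbors, both on the path, and
    the earlier one, [v1], closes a cycle with the rest of the path. As [x] comes first, this cycle
    contains [x] only if [v1] is [x], and then it starts with the edge from [x] to [y]. *)
Lemma exists_cycle_with_edge x y :
  symmetric e -> irreflexive e -> e x y ->
  (forall z, 1 < #|neighbors e z|) ->
  exists c, [/\ 2 < size c, ucycle e c
    & x \in c -> [set x; y] \in cycle_edges c].
Proof.
move=> e_sym e_irr xy deg2.
have [||q [pth unq max]] := @maximal_path x [:: y].
- by rewrite /= xy.
- by rewrite /= inE andbT; apply: contraTneq xy => ->; rewrite e_irr.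
set z := last _ _ in max; set s := x :: _ in unq max.
have zs : z \in s by apply: mem_last.
have [v1 [v2 [zv1 zv2 v12]]] :
    exists v1 v2, [/\ e z v1, e z v2 & index v1 s < index v2 s].
  have /card_gt1P[v1 [v2 []]] := deg2 z; rewrite !inE => zv1 zv2 v12.
  have [?|?|] := ltngtP (index v1 s) (index v2 s).
  - by exists v1, v2.
  - by exists v2, v1.
  by move/(index_inj x (max _ zv1) (max _ zv2)) => eq12; rewrite eq12 eqxx in v12.
have v1s := max _ zv1; have v2s := max _ zv2.
have [s1 [s2 def_s]] : exists s1 s2, s = s1 ++ v1 :: s2.
  by case/splitPr: v1s => s1 s2; exists s1, s2.
have unq_s : uniq (s1 ++ v1 :: s2) by rewrite -def_s.
have v1s1 : v1 \notin s1.
  by move: unq_s; rewrite cat_uniq /= => /and3P[_ /norP[]].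
(* After [v1] come both [v2] and [z], which differ since [z] is not its own neighbor. *)
have lt2 : 1 < size s2.
  have idx1 : index v1 s = size s1.
    by rewrite def_s index_cat (negPf v1s1) /= eqxx addn0.
  have idx_z : index z s = (size s).-1.
    have -> : z = nth x s (size s).-1 by rewrite nth_last.
    by rewrite index_uniq.
  have sz_s : size s = size s1 + (size s2).+1 by rewrite def_s size_cat.
  have i2 : index v2 s < size s by rewrite index_mem.
  have iz : index v2 s <> index z s.
    by move/(index_inj x v2s zs) => v2z; rewrite v2z e_irr in zv2.
  lia.
exists (v1 :: s2); split=> //.
  apply/andP; split; last by move: unq_s; rewrite cat_uniq => /and3P[].
  have last_z : last v1 s2 = z.
    have : last x s = z by [].
    by rewrite def_s last_cat.
  have : path e v1 s2.
    have : sorted e s by [].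
    by rewrite def_s => /cat_sorted2[].
  by rewrite /= rcons_path last_z zv1 andbT.
case: s1 => [|x1 s1] in def_s unq_s v1s1 *.
  move=> _; case: def_s => <- <-.
  apply/imsetP; exists x; first by rewrite mem_head.
  by rewrite /= eqxx.
case: def_s => -> _; move: unq_s => /= /andP[]; rewrite mem_cat => /norP[_].
by move/negPf ->.
Qed.

End ZeroForcing.

(** Removes the modulus hidden in [ordS], so that [lia] can decide adjacency. *)
Lemma cycle_graphE n (i j : 'I_n) :
  cycle_graph i j = [|| i.+1 == j, j.+1 == i, (i == 0 :> nat) && (j == n.-1 :> nat)
                      | (j == 0 :> nat) && (i == n.-1 :> nat)].
Proof.
have ordSE (a b : 'I_n) :
    (ordS a == b) = (a.+1 == b) || (b == 0 :> nat) && (a == n.-1 :> nat).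
  rewrite -val_eqE /=; have := ltn_ord a; rewrite leq_eqVlt => /orP[/eqP aE|a_lt].
    by rewrite aE modnn; have := ltn_ord b; lia.
  by rewrite modn_small //; have := ltn_ord b; lia.
rewrite /cycle_graph /= !ordSE; lia.
Qed.

Section Cycle.

Set Implicit Arguments.
Unset Strict Implicit.

Variables (T : finType) (e : rel T).
Hypotheses (e_sym : symmetric e) (e_irr : irreflexive e).

(** * Unicyclic graphs of minimum degree at least 2 *)

Lemma cycle_zero_forcing_number_ge2 c :
  2 < size c -> ucycle e c -> 1 < zero_forcing_number e.
Proof.
move=> sz_c /andP[cyc unq].
apply: (@zero_forcing_number_ge2 _ _ [set x in c]) => //.
  by case: c sz_c {cyc unq} => // x c _; apply/set0Pn; exists x; rewrite inE mem_head.
move=> x; rewrite inE => xc; apply/card_gt1P; exists (next c x), (prev c x).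
rewrite !inE mem_next mem_prev xc next_cycle // e_sym prev_cycle //; split=> //.
(* If successor and predecessor of [x] coincided, two steps along [c] would return to [x]. Rotating
   [c] to start at [x] shows that this fails for length above 2. *)
apply/eqP => nextE; have: next c (next c x) = x by rewrite {1}nextE next_prev.
have [i s sE] := rot_to xc.
have unq' : uniq (x :: s) by rewrite -sE rot_uniq.
have nextE' := next_rot i unq; rewrite sE in nextE'; rewrite -!nextE'.
have: 2 < size (x :: s) by rewrite -sE size_rot.
case: s unq' {sE nextE'} => [|y [|z s]] //= /andP[].
rewrite !inE => /norP[xy /norP[xz _]] _ _.
rewrite eqxx (eq_sym y) (negPf xy) eqxx => zx.
by rewrite zx eqxx in xz.
Qed.

Lemma unicyclic_min_degree2_iso :
  unicyclic e -> 1 < min_degree e ->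
  2 < #|T| /\ graph_isomorphic e (@cycle_graph #|T|).
Proof.
move=> [[_ conn] [C [[c [sz_c uc CE]] uniC]]] deg2.
have [cyc unq] := andP uc.
(* By uniqueness the cycle [d] has the same edges as [c]. Hence it passes through [x], and so it
   uses the edge from [x] to [y]. *)
have edge x y : x \in c -> e x y -> [set x; y] \in cycle_edges c.
  move=> xc xy.
  have [|d [sz_d ud d_xy]] := exists_cycle_with_edge e_sym e_irr xy.
    by move=> z; apply: leq_trans deg2 (min_degree_le e z).
  have cd : cycle_edges c = cycle_edges d.
    by rewrite -CE; apply: uniC; exists d.
  rewrite cd; apply: d_xy; apply: (@mem_cycle_edges _ d x (next c x)).
  by rewrite -cd; apply/imsetP; exists x.
have [x0 x0c] : exists x0, x0 \in c.
  by case: c sz_c {uc CE cyc unq edge} => // x c _; exists x; rewrite mem_head.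
(* By [edge], the vertices of [c] are closed under adjacency; connectedness does the rest. *)
have c_full x : x \in c.
  have /connectP[p pth ->] := conn x0 x.
  elim: p x0 x0c pth => //= y p IHp z zc /andP[zy]; apply: IHp.
  by apply: (@mem_cycle_edges _ _ y z); rewrite setUC; apply: edge.
have eE x y : e x y = (next c x == y) || (next c y == x).
  apply/idP/orP => [xy|[]/eqP <-]; last 2 first.
  - exact: next_cycle.
  - by rewrite e_sym next_cycle.
  have /imsetP[z _ /setP xyz] := edge x y (c_full x) xy.
  have := xyz x; have := xyz y; rewrite !inE !eqxx orbT /=.
  move=> /esym/orP[]/eqP yz /esym/orP[]/eqP xz; last by move: xy; rewrite yz -xz e_irr.
  - by move: xy; rewrite xz -yz e_irr.
  - by right; rewrite {1}yz -xz.
  - by left; rewrite {1}xz -yz.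
have sz : size c = #|T|.
  by rewrite -(card_uniqP unq); apply: eq_card => x; rewrite c_full.
split; first by rewrite -sz.
have idx_lt x : index x c < #|T| by rewrite -sz index_mem.
pose h x : 'I_#|T| := Ordinal (idx_lt x).
have h_inj : injective h.
  by move=> x y [] /(index_inj x0 (c_full x) (c_full y)).
have hS x : h (next c x) = ordS (h x).
  apply: val_inj => /=; rewrite next_nth c_full -sz.
  have := c_full x; case: (c) unq => [//|y c'] unq' xc.
  have := xc; rewrite -index_mem leq_eqVlt => /orP[/eqP idx|idx].
    (* At the last vertex [nth] runs past the tail and returns its default [y], the head of the
       cycle, which matches the wrap-around of [ordS]. *)
    by rewrite idx modnn nth_default /= ?eqxx // -ltnS idx.
  rewrite modn_small // -[nth _ _ _]/(nth y (y :: c') (index x (y :: c')).+1).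
  by rewrite index_uniq.
exists h; split.
  by apply: inj_card_bij => //; rewrite card_ord.
by move=> x y; rewrite eE /cycle_graph /= -!hS !(inj_eq h_inj).
Qed.

(** * Degrees and forcing in the cycle graph and its complement *)

Section Isomorphic.

Variables (n : nat) (h : T -> 'I_n) (g : 'I_n -> T).
Hypotheses (hK : cancel h g) (gK : cancel g h).
Hypothesis h_iso : forall x y, e x y = cycle_graph (h x) (h y).

Lemma eq_iso_preim x i : (x == g i) = (h x == i :> nat).
Proof. by rewrite -(can_eq hK) gK. Qed.

Lemma card_iso : #|T| = n.
Proof. by rewrite (bij_eq_card (Bijective hK gK)) card_ord. Qed.

Lemma iso_cycle_regular x : 2 < n -> #|neighbors e x| = 2.
Proof.
move=> n_gt2.
have -> : neighbors e x = [set g (ordS (h x)); g (ord_pred (h x))].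
  apply/setP=> y; rewrite !inE h_iso /cycle_graph /= -!(can2_eq hK gK).
  by rewrite -(can2_eq (@ordSK n) (@ord_predK n)) eq_sym.
(* Successor and predecessor differ because two successor steps move a label by 2, which is nonzero
   modulo [n] for [n > 2]. *)
rewrite cards2 (can_eq gK) -(can_eq (@ordSK n)) ord_predK -val_eqE /=.
have := ltn_ord (h x); move: (h x : nat) => i i_lt.
have [i1|i1] := eqVneq i.+1 n.
  by rewrite i1 modnn modn_small //; lia.
rewrite (@modn_small i.+1); last lia.
have [i2|i2] := eqVneq i.+2 n; first by rewrite i2 modnn; lia.
by rewrite modn_small; lia.
Qed.

(** The last vertex of an arc of at least two labels has a black predecessor, so it forces the next
    label. The induction on [k] shrinks the arc from the whole cycle down to the labels 0 and 1. *)
Lemma iso_cycle_zero_forcing_number : 2 < n -> zero_forcing_number e <= 2.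
Proof.
move=> n_gt2.
have zf k : 1 < n - k -> zero_forcing_set e [set x | h x < n - k].
  elim: k => [_|k IHk k_lt].
    rewrite subn0 (_ : [set _ | _] = [set: T]); first exact: connect0.
    by apply/setP=> x; rewrite !inE ltn_ord.
  have u_lt : (n - k.+1).-1 < n by lia.
  have w_lt : n - k.+1 < n by lia.
  apply: (@zero_forcing_set_force _ _ (g (Ordinal u_lt)) (g (Ordinal w_lt))).
  - by rewrite inE gK /=; lia.
  - move=> y; rewrite h_iso cycle_graphE eq_iso_preim inE gK /=.
    by have := ltn_ord (h y); lia.
  - rewrite (_ : _ |: _ = [set x | h x < n - k]); first by apply: IHk; lia.
    by apply/setP=> y; rewrite !inE eq_iso_preim /=; lia.
have n0 : 0 < n by lia.
have n1 : 1 < n by lia.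
have {zf}/zero_forcing_number_le zf : zero_forcing_set e [set x | h x < n - n.-2].
  by apply: zf; lia.
apply: leq_trans zf _.
have -> : [set x | h x < n - n.-2] = [set g (Ordinal n0); g (Ordinal n1)].
  by apply/setP=> x; rewrite !inE !eq_iso_preim /=; lia.
by rewrite cards2; case: (_ != _).
Qed.

(** In the complement, 0 misses 1 and [n-1], so it can force 2; then 2 misses 1, so it can force
    [n-1], which finally forces 1. The second force needs 2 and [n-1] to be nonconsecutive on the
    cycle, which fails for [n = 4]. *)
Lemma iso_cycle_compl_zero_forcing_number :
  4 < n -> zero_forcing_number (compl_graph e) <= n - 3.
Proof.
move=> n_gt4.
have n0 : 0 < n by lia.
have n1 : 1 < n by lia.
have n2 : 2 < n by lia.
have nl : n.-1 < n by lia.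
pose v0 := g (Ordinal n0); pose v1 := g (Ordinal n1).
pose v2 := g (Ordinal n2); pose vl := g (Ordinal nl).
have W3 : #|[set v1; v2; vl]| = 3.
  by rewrite setUC cardsU1 cards2 !inE !eq_iso_preim !gK /=; lia.
have -> : n - 3 = #|~: [set v1; v2; vl]|.
  by rewrite cardsCs setCK W3 card_iso.
have coE x y : compl_graph e x y = (h x != h y :> nat) && ~~ cycle_graph (h x) (h y).
  by rewrite /compl_graph /= h_iso -(can_eq hK).
apply: zero_forcing_number_le.
apply: (@zero_forcing_set_force _ _ v0 v2).
- by rewrite !inE !eq_iso_preim !gK /=; lia.
- move=> y; rewrite coE cycle_graphE !inE !eq_iso_preim !gK /=.
  by have := ltn_ord (h y); lia.
apply: (@zero_forcing_set_force _ _ v2 vl).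
- by rewrite !inE !eq_iso_preim !gK /=; lia.
- move=> y; rewrite coE cycle_graphE !inE !eq_iso_preim !gK /=.
  by have := ltn_ord (h y); lia.
apply: (@zero_forcing_set_force _ _ vl v1).
- by rewrite !inE !eq_iso_preim !gK /=; lia.
- move=> y; rewrite coE cycle_graphE !inE !eq_iso_preim !gK /=.
  by have := ltn_ord (h y); lia.
rewrite (_ : _ |: _ = [set: T]); first exact: connect0.
by apply/setP=> y; rewrite !inE !eq_iso_preim /=; lia.
Qed.

End Isomorphic.

End Cycle.

Theorem theorem3p2 (T : finType) (e : rel T) (n : nat)
    (e_sym : symmetric e) (e_irr : irreflexive e) (card_T : #|T| = n)
    (e_uni : unicyclic e) :
  zero_forcing_number e + zero_forcing_number (compl_graph e)
    = min_degree e + min_degree (compl_graph e)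
  <-> (5 <= n /\ graph_isomorphic e (@cycle_graph n)).
Proof.
have T_gt0 : 0 < #|T| by have [[]] := e_uni.
have co_irr : irreflexive (compl_graph e) by move=> x; rewrite /compl_graph /= eqxx.
have co_sym : symmetric (compl_graph e).
  by move=> x y; rewrite /compl_graph /= eq_sym e_sym.
have leZ := min_degree_le_zero_forcing_number T_gt0 e_irr.
have leZco := min_degree_le_zero_forcing_number T_gt0 co_irr.
subst n; split=> [eqZ | [n_gt4 [h [[g hK gK] h_iso]]]]; last first.
  have deg x : #|neighbors e x| = 2.
    by apply: (iso_cycle_regular hK gK h_iso); lia.
  have codeg x : #|neighbors (compl_graph e) x| = #|T| - 3.
    by rewrite card_neighbors_compl // deg.
  (* The upper bounds 2 and [n-3] on the zero forcing numbers equal the degrees, so [leZ] and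
     [leZco] are equalities. *)
  have := iso_cycle_zero_forcing_number hK gK h_iso.
  have := iso_cycle_compl_zero_forcing_number hK gK h_iso.
  have := min_degree_regular T_gt0 deg; have := min_degree_regular T_gt0 codeg.
  lia.
have Z_gt1 : 1 < zero_forcing_number e.
  have [_ [_ [[c [sz_c uc _]] _]]] := e_uni.
  exact: cycle_zero_forcing_number_ge2 sz_c uc.
have [|n_gt2 iso] := unicyclic_min_degree2_iso e_sym e_irr e_uni; first lia.
split=> //; have [h [[g hK gK] h_iso]] := iso.
have codeg x : #|neighbors (compl_graph e) x| = #|T| - 3.
  by rewrite card_neighbors_compl // (iso_cycle_regular hK gK h_iso).
have co_min := min_degree_regular T_gt0 codeg.
(* The complement is regular of degree [n-3], at most 1 here, and its zero forcing number equals
   that degree because [leZco] is tight. But [n <= 2(n-3)] fails for [n] equal to 3 or 4. *)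
rewrite ltnNge; apply/negP => n_le4.
have: #|T| <= (zero_forcing_number (compl_graph e)).*2.
  by apply: card_le_double_zero_forcing_number => // x; rewrite codeg; lia.
lia.
Qed.
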